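(* Let $x$ be a $\lambda$-variable and let $M_1,\dots,M_n$ be (un-typed) $\lambda\mu$-terms which are strongly normalizing for the $\beta\mu\mu'$-reduction. Then the term $(x\; M_1\;\dots\; M_n)$ is strongly normalizing for the $\beta\mu\mu'$-reduction.
   Context: $\lambda\mu$-terms are generated by the grammar $t ::= x \mid \lambda x\, t \mid (t\; t) \mid \mu\alpha\, t \mid (\alpha\; t)$, where $x,y,\dots$ are $\lambda$-variables and $\alpha,\beta,\dots$ are $\mu$-variables (two disjoint infinite sets); $\lambda x$ and $\mu\alpha$ are binders, terms are considered up to renaming of bound variables and substitutions are capture-avoiding. $(M\;P_1\dots P_n)$ is the left-associated iterated application. $M[\alpha=_rN]$ is obtained from $M$ by replacing (recursively) each sub-term $(\alpha\; U)$, $\alpha$ free, by $(\alpha\; (U\; N))$; $M[\alpha=_lN]$ is obtained by replacing (recursively) each such sub-term by $(\alpha\; (N\; U))$. The $\beta\mu\mu'$-reduction is the closure under all term constructors of the rules $(\lambda x M\; N)\triangleright M[x:=N]$ (rule $\beta$), $(\mu\alpha M\; N)\triangleright \mu\alpha\, M[\alpha=_rN]$ (rule $\mu$) and $(M\;\mu\alpha N)\triangleright\mu\alpha\, N[\alpha=_lM]$ (rule $\mu'$). A term is strongly normalizing if it has no infinite reduction. No typing is assumed. *)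

(* Defs.v *)
From Stdlib Require Import PeanoNat List.

(** Terms up to renaming of bound variables are represented by de Bruijn
    indices, with two independent index spaces: [Lam] binds the lambda-index 0
    of its body and leaves mu-indices alone, [Mu] binds the mu-index 0 of its
    body and leaves lambda-indices alone. Terms may be open: an index exceeding
    the number of enclosing binders of its sort denotes a free variable.
    [Nam a t] is [(alpha t)]. *)
Inductive term : Type :=
| Var (x : nat)
| Lam (t : term)
| App (t u : term)
| Mu (t : term)
| Nam (a : nat) (t : term).

Definition upren (f : nat -> nat) (n : nat) : nat :=
  match n with 0 => 0 | S m => S (f m) end.

(** [ren f g t]: rename the free lambda-variables by [f], the free mu-variables
    by [g]. *)
Fixpoint ren (f g : nat -> nat) (t : term) : term :=
  match t with
  | Var x => Var (f x)
  | Lam t => Lam (ren (upren f) g t)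
  | App t u => App (ren f g t) (ren f g u)
  | Mu t => Mu (ren f (upren g) t)
  | Nam a t => Nam (g a) (ren f g t)
  end.

(** Weakenings, needed to carry a term under a binder without capture. *)
Definition wkl (t : term) : term := ren S (fun a => a) t.
Definition wkm (t : term) : term := ren (fun x => x) S t.

Definition upl (s : nat -> term) (n : nat) : term :=
  match n with 0 => Var 0 | S m => wkl (s m) end.

(** Simultaneous substitution for the free lambda-variables. *)
Fixpoint subst (s : nat -> term) (t : term) : term :=
  match t with
  | Var x => s x
  | Lam t => Lam (subst (upl s) t)
  | App t u => App (subst s t) (subst s u)
  | Mu t => Mu (subst (fun x => wkm (s x)) t)
  | Nam a t => Nam a (subst s t)
  end.

(** [M[x := N]] where [x] is the lambda-index 0, whose binder disappears: the
    other free lambda-indices are decremented. *)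
Definition subst0 (N M : term) : term :=
  subst (fun n => match n with 0 => N | S m => Var m end) M.

(** [M[a =_r N]] and [M[a =_l N]]; the mu-variable [a] is kept. *)
Fixpoint rsub (a : nat) (N M : term) : term :=
  match M with
  | Var x => Var x
  | Lam t => Lam (rsub a (wkl N) t)
  | App t u => App (rsub a N t) (rsub a N u)
  | Mu t => Mu (rsub (S a) (wkm N) t)
  | Nam b U =>
      if Nat.eqb b a then Nam b (App (rsub a N U) N) else Nam b (rsub a N U)
  end.

Fixpoint lsub (a : nat) (N M : term) : term :=
  match M with
  | Var x => Var x
  | Lam t => Lam (lsub a (wkl N) t)
  | App t u => App (lsub a N t) (lsub a N u)
  | Mu t => Mu (lsub (S a) (wkm N) t)
  | Nam b U =>
      if Nat.eqb b a then Nam b (App N (lsub a N U)) else Nam b (lsub a N U)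
  end.

(** In the [mu] and [mu'] rules the other component of the redex enters the
    scope of the [Mu], hence the [wkm]. *)
Inductive red : term -> term -> Prop :=
| red_beta (M N : term) : red (App (Lam M) N) (subst0 N M)
| red_mu (M N : term) : red (App (Mu M) N) (Mu (rsub 0 (wkm N) M))
| red_mu' (M N : term) : red (App M (Mu N)) (Mu (lsub 0 (wkm M) N))
| red_Lam (M M' : term) : red M M' -> red (Lam M) (Lam M')
| red_App_l (M M' N : term) : red M M' -> red (App M N) (App M' N)
| red_App_r (M N N' : term) : red N N' -> red (App M N) (App M N')
| red_Mu (M M' : term) : red M M' -> red (Mu M) (Mu M')
| red_Nam (a : nat) (M M' : term) : red M M' -> red (Nam a M) (Nam a M').

Definition SN (t : term) : Prop :=
  ~ exists s : nat -> term, s 0 = t /\ forall i : nat, red (s i) (s (S i)).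

Definition apps (M : term) (Ps : list term) : term := fold_left App Ps M.

(* Main.v *)
(** An instance of a strongly normalizing term [N] replaces each [(a U)] by
    [(a (k U))], where the frame [k] applies its hole successively to arguments
    on either side.  No rule eliminates a term [(a U)], so if an instance of [N]
    reduces to an abstraction, then so does [N], up to instantiation.
    Call an instance of [N] good if each of its frames stays strongly
    normalizing when filled with a good instance of a term [N'] below [N], in
    the order generated by reduction and subterms; this is a recursion on [N].
    Good instances are strongly normalizing, by induction on [N].
    In [(x T1 ... Tn)] with each [Ti] a good instance of [Ni], the only
    interaction is that some [Ti] reduces to [Mu Q] and absorbs
    [(x T1 ... T(i-1))] on the left and [T(i+1)], ..., [Tn] on the right.  The
    result is an instance of a term [Q'] below [Ni] with one new frame
    [(x T1 ... [] ... Tn)], and this frame is good by induction on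
    [(N1, ..., Nn)], one component of which decreases. *)

Require Import Defs.
From Stdlib Require Import List.
From Stdlib Require Import PeanoNat Relations Wellfounded.
From Stdlib Require Import FunctionalExtensionality Classical ClassicalEpsilon.
Import ListNotations.

(* The boolean is [true] for an argument put on the right, as in [=_r]. *)
Definition frame : Type := list (bool * term).

Definition plug (k : frame) (U : term) : term :=
  fold_left (fun V p => if fst p : bool then App V (snd p) else App (snd p) V) k U.

Definition mapf (h : term -> term) (k : frame) : frame :=
  map (fun p => (fst p, h (snd p))) k.

Definition upf (K : nat -> frame) (a : nat) : frame :=
  match a with 0 => [] | S b => mapf wkm (K b) end.

(* Besides substituting, [sub] renames the mu-variables by [g]; the case [K a = []]
   leaves [(a U)] unframed, so [ren], [subst], [rsub] and [lsub] are all
   instances. *)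
Fixpoint sub (s : nat -> term) (g : nat -> nat) (K : nat -> frame) (t : term)
  : term :=
  match t with
  | Var x => s x
  | Lam t => Lam (sub (upl s) g (fun a => mapf wkl (K a)) t)
  | App t u => App (sub s g K t) (sub s g K u)
  | Mu t => Mu (sub (fun x => wkm (s x)) (upren g) (upf K) t)
  | Nam a t => Nam (g a) (plug (K a) (sub s g K t))
  end.

Definition no_frame (a : nat) : frame := [].

Definition id_nat (n : nat) : nat := n.

(** * Algebra of simultaneous substitutions *)

Lemma mapf_mapf h1 h2 k : mapf h1 (mapf h2 k) = mapf (fun t => h1 (h2 t)) k.
Proof. unfold mapf. now rewrite map_map. Qed.

Lemma mapf_ext h1 h2 k : (forall t, h1 t = h2 t) -> mapf h1 k = mapf h2 k.
Proof. intros H. apply map_ext. intros [b t]; simpl. now rewrite H. Qed.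

Lemma mapf_id h k : (forall t, h t = t) -> mapf h k = k.
Proof.
  intros H. unfold mapf. rewrite <- (map_id k) at 2. apply map_ext.
  intros [b t]; simpl. now rewrite H.
Qed.

Lemma mapf_app h k1 k2 : mapf h (k1 ++ k2) = mapf h k1 ++ mapf h k2.
Proof. apply map_app. Qed.

Lemma plug_app k1 k2 U : plug (k1 ++ k2) U = plug k2 (plug k1 U).
Proof. apply fold_left_app. Qed.

Lemma plug_morph (h : term -> term) k U :
  (forall A B, h (App A B) = App (h A) (h B)) ->
  h (plug k U) = plug (mapf h k) (h U).
Proof.
  intros H. revert U. induction k as [|[[] N] k IH]; intros U; simpl;
    trivial; unfold plug in *; simpl; rewrite IH, H; reflexivity.
Qed.

Lemma upren_comp f g : (fun n => upren f (upren g n)) = upren (fun n => f (g n)).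
Proof. extensionality n. now destruct n. Qed.

Lemma upren_id : upren id_nat = id_nat.
Proof. extensionality n. now destruct n. Qed.

Lemma upf_no_frame : upf no_frame = no_frame.
Proof. extensionality n. now destruct n. Qed.

Lemma upl_Var f : upl (fun x => Var (f x)) = (fun x => Var (upren f x)).
Proof. extensionality n. now destruct n. Qed.

Lemma ren_ren f1 g1 f2 g2 t :
  ren f1 g1 (ren f2 g2 t) = ren (fun n => f1 (f2 n)) (fun n => g1 (g2 n)) t.
Proof.
  revert f1 g1 f2 g2; induction t; intros; simpl;
    rewrite ?IHt, ?IHt1, ?IHt2, ?upren_comp; reflexivity.
Qed.

Lemma ren_id t : ren id_nat id_nat t = t.
Proof.
  induction t; simpl; rewrite ?upren_id, ?IHt, ?IHt1, ?IHt2; reflexivity.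
Qed.

Lemma ren_sub_Var f g t : ren f g t = sub (fun x => Var (f x)) g no_frame t.
Proof.
  revert f g; induction t; intros; simpl; rewrite ?IHt, ?IHt1, ?IHt2; trivial.
  - now rewrite upl_Var.
  - now rewrite upf_no_frame.
Qed.

Lemma sub_ren s g K f' g' t :
  sub s g K (ren f' g' t) =
  sub (fun x => s (f' x)) (fun a => g (g' a)) (fun a => K (g' a)) t.
Proof.
  revert s g K f' g'; induction t; intros; simpl;
    rewrite ?IHt, ?IHt1, ?IHt2; trivial.
  - do 2 f_equal. extensionality n. now destruct n.
  - do 2 f_equal; extensionality n; now destruct n.
Qed.

Lemma ren_sub f' g' s g K t :
  ren f' g' (sub s g K t) =
  sub (fun x => ren f' g' (s x)) (fun a => g' (g a))
    (fun a => mapf (ren f' g') (K a)) t.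
Proof.
  revert s g K f' g'; induction t; intros; simpl;
    rewrite ?IHt, ?IHt1, ?IHt2; trivial.
  - do 2 f_equal.
    + extensionality n. destruct n; simpl; trivial.
      unfold wkl. now rewrite !ren_ren.
    + extensionality a. rewrite !mapf_mapf. apply mapf_ext. intros u.
      unfold wkl. now rewrite !ren_ren.
  - do 2 f_equal.
    + extensionality n. unfold wkm. now rewrite !ren_ren.
    + extensionality n. now destruct n.
    + extensionality a. destruct a; simpl; trivial.
      rewrite !mapf_mapf. apply mapf_ext. intros u.
      unfold wkm. now rewrite !ren_ren.
  - rewrite (plug_morph (ren f' g')) by trivial. now rewrite IHt.
Qed.

Lemma sub_wkl s g K t :
  sub (upl s) g (fun a => mapf wkl (K a)) (wkl t) = wkl (sub s g K t).
Proof. unfold wkl. now rewrite sub_ren, ren_sub. Qed.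

Lemma sub_wkm s g K t :
  sub (fun x => wkm (s x)) (upren g) (upf K) (wkm t) = wkm (sub s g K t).
Proof. unfold wkm. now rewrite sub_ren, ren_sub. Qed.

(** Composition appends frames. The arguments of [K a] undergo the second substitution, and the
    outer frame is [K' (g a)] because [a] has by then been renamed to [g a]. *)
Lemma sub_sub s' g' K' s g K t :
  sub s' g' K' (sub s g K t) =
  sub (fun x => sub s' g' K' (s x)) (fun a => g' (g a))
    (fun a => mapf (sub s' g' K') (K a) ++ K' (g a)) t.
Proof.
  revert s g K s' g' K'; induction t; intros; simpl;
    rewrite ?IHt, ?IHt1, ?IHt2; trivial.
  - do 2 f_equal.
    + extensionality n. destruct n; simpl; trivial. now rewrite sub_wkl.
    + extensionality a. rewrite mapf_app, !mapf_mapf. f_equal.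
      apply mapf_ext. intros u. apply sub_wkl.
  - do 2 f_equal.
    + extensionality n. now rewrite sub_wkm.
    + extensionality n. now destruct n.
    + extensionality a. destruct a; simpl; trivial.
      rewrite mapf_app, !mapf_mapf. f_equal.
      apply mapf_ext. intros u. apply sub_wkm.
  - rewrite (plug_morph (sub s' g' K')) by trivial. now rewrite IHt, plug_app.
Qed.

Lemma sub_Var t : sub Var id_nat no_frame t = t.
Proof. rewrite <- (ren_id t) at 2. now rewrite ren_sub_Var. Qed.

(** * The substitutions of the calculus as simultaneous substitutions *)

Lemma subst_sub s t : subst s t = sub s id_nat no_frame t.
Proof.
  revert s; induction t; intros; simpl; rewrite ?IHt, ?IHt1, ?IHt2; trivial.
  now rewrite upren_id, upf_no_frame.
Qed.

Definition scons (N : term) (n : nat) : term :=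
  match n with 0 => N | S m => Var m end.

Lemma subst0_sub N M : subst0 N M = sub (scons N) id_nat no_frame M.
Proof. apply subst_sub. Qed.

Definition single (a : nat) (b : bool) (N : term) (c : nat) : frame :=
  if Nat.eqb c a then [(b, N)] else [].

Lemma upf_single a b N : upf (single a b N) = single (S a) b (wkm N).
Proof.
  extensionality c. destruct c as [|c]; simpl; trivial.
  unfold single; simpl. now destruct (Nat.eqb c a).
Qed.

Lemma mapf_single h a b N c : mapf h (single a b N c) = single a b (h N) c.
Proof. unfold single. now destruct (Nat.eqb c a). Qed.

Lemma rsub_sub a N t : rsub a N t = sub Var id_nat (single a true N) t.
Proof.
  revert a N; induction t; intros; simpl; rewrite ?IHt, ?IHt1, ?IHt2; trivial.
  - do 2 f_equal; [|extensionality n; now rewrite mapf_single].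
    extensionality n. now destruct n.
  - now rewrite upren_id, upf_single.
  - change (id_nat a) with a. unfold single at 3. now destruct (Nat.eqb a a0).
Qed.

Lemma lsub_sub a N t : lsub a N t = sub Var id_nat (single a false N) t.
Proof.
  revert a N; induction t; intros; simpl; rewrite ?IHt, ?IHt1, ?IHt2; trivial.
  - do 2 f_equal; [|extensionality n; now rewrite mapf_single].
    extensionality n. now destruct n.
  - now rewrite upren_id, upf_single.
  - change (id_nat a) with a. unfold single at 3. now destruct (Nat.eqb a a0).
Qed.

Lemma sub_subst0 s g K N M :
  sub s g K (subst0 N M) =
  subst0 (sub s g K N) (sub (upl s) g (fun a => mapf wkl (K a)) M).
Proof.
  rewrite !subst0_sub, !sub_sub. f_equal.
  - extensionality n. destruct n; simpl; trivial.
    unfold wkl. rewrite sub_ren. symmetry. apply sub_Var.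
  - extensionality a. rewrite mapf_mapf, app_nil_r. symmetry. apply mapf_id.
    intros u. unfold wkl. rewrite sub_ren. apply sub_Var.
Qed.

Lemma single_wkm b N t : sub Var id_nat (single 0 b N) (wkm t) = wkm t.
Proof. unfold wkm. now rewrite sub_ren, ren_sub_Var. Qed.

(** Under the [Mu], [upf K] leaves index 0 unframed while [single 0] frames index 0 only, so the
    frames do not interfere. Weakened terms do not mention index 0 and come through unchanged. *)
Lemma sub_single s g K b N M :
  sub (fun x => wkm (s x)) (upren g) (upf K)
    (sub Var id_nat (single 0 b (wkm N)) M) =
  sub Var id_nat (single 0 b (wkm (sub s g K N)))
    (sub (fun x => wkm (s x)) (upren g) (upf K) M).
Proof.
  rewrite !sub_sub. f_equal.
  - extensionality n. now rewrite single_wkm.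
  - extensionality a. rewrite mapf_single, sub_wkm. destruct a; simpl; trivial.
    unfold single; simpl. rewrite app_nil_r, mapf_mapf. apply mapf_ext.
    intros u. symmetry. apply single_wkm.
Qed.

(** * Reduction and substitution *)

Definition reds : term -> term -> Prop := clos_refl_trans_1n term red.

Lemma reds_refl M : reds M M.
Proof. constructor. Qed.

Lemma reds_step M N P : red M N -> reds N P -> reds M P.
Proof. econstructor; eauto. Qed.

Lemma reds_trans M N P : reds M N -> reds N P -> reds M P.
Proof. intros H. revert P. induction H; eauto using reds_step. Qed.

Lemma red_reds M N : red M N -> reds M N.
Proof. eauto using reds_step, reds_refl. Qed.

Lemma reds_map (h : term -> term) M N :
  (forall M N, red M N -> red (h M) (h N)) -> reds M N -> reds (h M) (h N).
Proof. intros Hh H. induction H; eauto using reds_step, reds_refl. Qed.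

Lemma reds_App M M' N N' : reds M M' -> reds N N' -> reds (App M N) (App M' N').
Proof.
  intros HM HN. apply reds_trans with (App M' N).
  - apply (reds_map (fun M => App M N)); auto using red_App_l.
  - apply reds_map; auto using red_App_r.
Qed.

Lemma red_plug k U V : red U V -> red (plug k U) (plug k V).
Proof.
  revert U V. induction k as [|[[] N] k IH]; intros U V H; simpl; trivial;
    apply IH; simpl; auto using red_App_l, red_App_r.
Qed.

Lemma red_sub s g K M N : red M N -> red (sub s g K M) (sub s g K N).
Proof.
  intros H. revert s g K.
  induction H; intros; simpl; try (constructor; auto using red_plug; fail).
  - rewrite sub_subst0. constructor.
  - rewrite !rsub_sub, sub_single, <- rsub_sub. constructor.
  - rewrite !lsub_sub, sub_single, <- lsub_sub. constructor.
Qed.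

Lemma red_ren f g M N : red M N -> red (ren f g M) (ren f g N).
Proof. rewrite !ren_sub_Var. apply red_sub. Qed.

Definition redsf : frame -> frame -> Prop :=
  Forall2 (fun p q => fst p = fst q /\ reds (snd p) (snd q)).

Lemma redsf_refl k : redsf k k.
Proof. induction k; constructor; auto using reds_refl. Qed.

Lemma redsf_mapf h k k' :
  (forall M N, red M N -> red (h M) (h N)) ->
  redsf k k' -> redsf (mapf h k) (mapf h k').
Proof.
  intros Hh H. induction H as [|p q k k' [Hb Ht]]; constructor; simpl; auto.
  split; auto using reds_map.
Qed.

Lemma reds_plug k k' U U' :
  redsf k k' -> reds U U' -> reds (plug k U) (plug k' U').
Proof.
  intros H. revert U U'.
  induction H as [|[b t] [b' t'] k k' [Hb Ht] _ IH]; intros U U' HU; simpl; auto.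
  simpl in Hb, Ht. subst b'. apply IH. destruct b; auto using reds_App.
Qed.

(** Substitution may copy or erase an argument, so one step in it becomes any number of steps; hence
    [reds] rather than [red]. *)
Lemma reds_sub_arg s s' g K K' M :
  (forall x, reds (s x) (s' x)) -> (forall a, redsf (K a) (K' a)) ->
  reds (sub s g K M) (sub s' g K' M).
Proof.
  revert s s' g K K'. induction M; intros s s' g K K' Hs HK; simpl;
    auto using reds_App.
  - apply reds_map; [auto using red_Lam|]. apply IHM.
    + intros [|x]; simpl; [apply reds_refl|].
      apply reds_map; [apply red_ren|apply Hs].
    + intros a. apply redsf_mapf; [apply red_ren|apply HK].
  - apply reds_map; [auto using red_Mu|]. apply IHM.
    + intros x. apply reds_map; [apply red_ren|apply Hs].
    + intros [|a]; [apply redsf_refl|].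
      apply redsf_mapf; [apply red_ren|apply HK].
  - apply reds_map; [auto using red_Nam|]. apply reds_plug; auto.
Qed.

Lemma reds_subst0 M M' N N' :
  reds M M' -> reds N N' -> reds (subst0 N M) (subst0 N' M').
Proof.
  intros HM HN. rewrite !subst0_sub.
  apply reds_trans with (sub (scons N) id_nat no_frame M').
  - apply reds_map; auto using red_sub.
  - apply reds_sub_arg; [|intros; apply redsf_refl].
    intros [|x]; [trivial|apply reds_refl].
Qed.

Lemma reds_single b M M' N N' :
  reds M M' -> reds N N' ->
  reds (sub Var id_nat (single 0 b (wkm N)) M)
    (sub Var id_nat (single 0 b (wkm N')) M').
Proof.
  intros HM HN.
  apply reds_trans with (sub Var id_nat (single 0 b (wkm N)) M').
  - apply reds_map; auto using red_sub.
  - apply reds_sub_arg; [intros; apply reds_refl|].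
    intros [|a]; simpl; constructor; [|constructor].
    split; trivial. apply reds_map; trivial. apply red_ren.
Qed.

Lemma reds_rsub M M' N N' :
  reds M M' -> reds N N' -> reds (rsub 0 (wkm N) M) (rsub 0 (wkm N') M').
Proof. rewrite !rsub_sub. apply reds_single. Qed.

Lemma reds_lsub M M' N N' :
  reds M M' -> reds N N' -> reds (lsub 0 (wkm N) M) (lsub 0 (wkm N') M').
Proof. rewrite !lsub_sub. apply reds_single. Qed.

(** * Reducts of applications *)

Lemma reds_Mu_inv M N : reds (Mu M) N -> exists N', N = Mu N' /\ reds M N'.
Proof.
  intros H. remember (Mu M) as T eqn:E. revert M E.
  induction H as [|T T1 T' Hr H IH]; intros; subst; eauto using reds_refl.
  inversion Hr; subst. destruct (IH _ eq_refl) as (N' & -> & HN).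
  eauto using reds_step.
Qed.

Lemma reds_Lam_inv M N : reds (Lam M) N -> exists N', N = Lam N' /\ reds M N'.
Proof.
  intros H. remember (Lam M) as T eqn:E. revert M E.
  induction H as [|T T1 T' Hr H IH]; intros; subst; eauto using reds_refl.
  inversion Hr; subst. destruct (IH _ eq_refl) as (N' & -> & HN).
  eauto using reds_step.
Qed.

Lemma reds_Nam_inv a M N : reds (Nam a M) N -> exists N', N = Nam a N'.
Proof.
  intros H. remember (Nam a M) as T eqn:E. revert M E.
  induction H as [|T T1 T' Hr H IH]; intros; subst; eauto.
  inversion Hr; subst; eauto.
Qed.

Lemma reds_Var_inv x N : reds (Var x) N -> N = Var x.
Proof. inversion 1 as [|? ? Hr]; trivial. inversion Hr. Qed.

(** A [Mu] only reduces to a [Mu], so the first root contraction must be a beta step. Steps made in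
    [N] before it are replayed afterwards in the contractum, which is why the original [N] appears
    in the conclusion. *)
Lemma reds_App_Lam M N P :
  reds (App M N) (Lam P) ->
  exists Q, reds M (Lam Q) /\ reds (subst0 N Q) (Lam P).
Proof.
  intros H. remember (App M N) as T eqn:ET. remember (Lam P) as T' eqn:ET'.
  revert M N ET. induction H as [|T T1 T' Hr H IH]; intros; subst; [discriminate|].
  specialize (IH eq_refl).
  inversion Hr; subst.
  - eauto using reds_refl.
  - apply reds_Mu_inv in H. destruct H as (? & [=] & _).
  - apply reds_Mu_inv in H. destruct H as (? & [=] & _).
  - destruct (IH _ _ eq_refl) as (Q & H1 & H2). eauto using reds_step.
  - destruct (IH _ _ eq_refl) as (Q & H1 & H2). exists Q. split; trivial.
    eapply reds_trans; [|apply H2].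
    apply reds_subst0; auto using reds_refl, red_reds.
Qed.

(** One case for each rule that can first contract the root, with the same postponement of the steps
    made on the other side. *)
Lemma reds_App_Mu M N P :
  reds (App M N) (Mu P) ->
  (exists Q, reds M (Lam Q) /\ reds (subst0 N Q) (Mu P)) \/
  (exists Q, reds M (Mu Q) /\ reds (rsub 0 (wkm N) Q) P) \/
  (exists Q, reds N (Mu Q) /\ reds (lsub 0 (wkm M) Q) P).
Proof.
  intros H. remember (App M N) as T eqn:ET. remember (Mu P) as T' eqn:ET'.
  revert M N ET. induction H as [|T T1 T' Hr H IH]; intros; subst; [discriminate|].
  specialize (IH eq_refl).
  inversion Hr; subst.
  - left. eauto using reds_refl.
  - right; left. apply reds_Mu_inv in H. destruct H as (N' & [= ->] & H).
    eauto using reds_refl.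
  - right; right. apply reds_Mu_inv in H. destruct H as (N' & [= ->] & H).
    eauto using reds_refl.
  - destruct (IH _ _ eq_refl) as [(Q & H1 & H2)|[(Q & H1 & H2)|(Q & H1 & H2)]].
    + left. eauto using reds_step.
    + right; left. eauto using reds_step.
    + right; right. exists Q. split; trivial. eapply reds_trans; [|apply H2].
      apply reds_lsub; auto using reds_refl, red_reds.
  - destruct (IH _ _ eq_refl) as [(Q & H1 & H2)|[(Q & H1 & H2)|(Q & H1 & H2)]].
    + left. exists Q. split; trivial. eapply reds_trans; [|apply H2].
      apply reds_subst0; auto using reds_refl, red_reds.
    + right; left. exists Q. split; trivial. eapply reds_trans; [|apply H2].
      apply reds_rsub; auto using reds_refl, red_reds.
    + right; right. eauto using reds_step.
Qed.

(** * Strong normalization *)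

Definition sn : term -> Prop := Acc (fun N M => red M N).

Lemma sn_reds M N : sn M -> reds M N -> sn N.
Proof. intros HM H. induction H; trivial. apply IHclos_refl_trans_1n. now apply HM. Qed.

Lemma sn_map_inv (h : term -> term) M :
  (forall M N, red M N -> red (h M) (h N)) -> sn (h M) -> sn M.
Proof.
  intros Hh H. remember (h M) as T eqn:E. revert M E.
  induction H as [T _ IH]; intros M ->. constructor. intros N HN.
  now apply (IH (h N)); auto.
Qed.

Lemma sn_Lam M : sn M -> sn (Lam M).
Proof.
  induction 1 as [M _ IH]. constructor. intros N HN. inversion HN; subst. now apply IH.
Qed.

Lemma sn_Mu M : sn M -> sn (Mu M).
Proof.
  induction 1 as [M _ IH]. constructor. intros N HN. inversion HN; subst. now apply IH.
Qed.

Lemma sn_Nam a M : sn M -> sn (Nam a M).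
Proof.
  induction 1 as [M _ IH]. constructor. intros N HN. inversion HN; subst. now apply IH.
Qed.

Lemma sn_Var x : sn (Var x).
Proof. constructor. intros N HN. inversion HN. Qed.

(** By induction on both sides, only root contractions matter. Each hypothesis reduces the side that
    exposes a [Lam] or a [Mu] and keeps the other side fixed; reducing that other side merely
    reduces the contractum, so the hypotheses survive the induction. *)
Lemma sn_App M N :
  sn M -> sn N ->
  (forall P, reds M (Lam P) -> sn (subst0 N P)) ->
  (forall P, reds M (Mu P) -> sn (Mu (rsub 0 (wkm N) P))) ->
  (forall P, reds N (Mu P) -> sn (Mu (lsub 0 (wkm M) P))) ->
  sn (App M N).
Proof.
  intros HM. revert N. induction HM as [M HM IHM]. intros N HN.
  induction HN as [N HN IHN]. intros Hl Hr Hr'. constructor. intros T HT.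
  inversion HT; subst.
  - apply Hl, reds_refl.
  - apply Hr, reds_refl.
  - apply Hr', reds_refl.
  - apply IHM; trivial.
    + now constructor.
    + eauto using reds_step.
    + eauto using reds_step.
    + intros P HP. apply sn_reds with (Mu (lsub 0 (wkm M) P)); [now apply Hr'|].
      apply reds_map; [apply red_Mu|].
      apply reds_lsub; auto using reds_refl, red_reds.
  - apply IHN; trivial.
    + intros P HP. apply sn_reds with (subst0 N P); [now apply Hl|].
      apply reds_subst0; auto using reds_refl, red_reds.
    + intros P HP. apply sn_reds with (Mu (rsub 0 (wkm N) P)); [now apply Hr|].
      apply reds_map; [apply red_Mu|].
      apply reds_rsub; auto using reds_refl, red_reds.
    + eauto using reds_step.
Qed.

Lemma SN_sn M : SN M -> sn M.
Proof.
  intros HM. apply NNPP. intros Hn. apply HM.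
  (* Classically, a term outside [sn] has a reduct outside [sn]; choice turns this into a function,
     which is then iterated from [M]. *)
  assert (step : forall p : {t | ~ sn t},
             {q : {t | ~ sn t} | red (proj1_sig p) (proj1_sig q)}).
  { intros [t Ht]. apply constructive_indefinite_description. simpl.
    apply NNPP. intros Hno. apply Ht. constructor. intros u Hu.
    apply NNPP. intros Hu'. apply Hno. now exists (exist _ u Hu'). }
  exists (fun i => proj1_sig
    (nat_rect (fun _ => {t | ~ sn t}) (exist _ M Hn)
       (fun _ p => proj1_sig (step p)) i)).
  split; trivial. intros i. simpl. apply (proj2_sig (step _)).
Qed.

Lemma sn_SN M : sn M -> SN M.
Proof.
  induction 1 as [M _ IH]. intros (s & <- & Hs).
  apply (IH (s 1) (Hs 0)). exists (fun i => s (S i)). auto.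
Qed.

(** * The order generated by reduction and subterms *)

Inductive smaller : term -> term -> Prop :=
| smaller_red M N : red M N -> smaller N M
| smaller_Lam M : smaller M (Lam M)
| smaller_App_l M N : smaller M (App M N)
| smaller_App_r M N : smaller N (App M N)
| smaller_Mu M : smaller M (Mu M)
| smaller_Nam a M : smaller M (Nam a M).

Inductive subterm (u : term) : term -> Prop :=
| subterm_refl : subterm u u
| subterm_Lam M : subterm u M -> subterm u (Lam M)
| subterm_App_l M N : subterm u M -> subterm u (App M N)
| subterm_App_r M N : subterm u N -> subterm u (App M N)
| subterm_Mu M : subterm u M -> subterm u (Mu M)
| subterm_Nam a M : subterm u M -> subterm u (Nam a M).

Lemma subterm_red u v t :
  subterm u t -> red u v -> exists t', red t t' /\ subterm v t'.
Proof.
  intros H Hr. induction H as [|? ? IH|? ? ? IH|? ? ? IH|? ? IH|? ? ? IH];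
    [eauto using subterm_refl|..]; destruct IH as (t' & H1 & H2);
    eexists; (split; [constructor; eassumption|]).
  - now apply subterm_Lam.
  - now apply subterm_App_l.
  - now apply subterm_App_r.
  - now apply subterm_Mu.
  - now apply subterm_Nam.
Qed.

Lemma subterm_trans u v t : subterm u v -> subterm v t -> subterm u t.
Proof. intros H H'. induction H'; trivial; now constructor. Qed.

(** The claim is strengthened to all subterms [u] of [M]. A step of [u] lifts to a step of [M] and
    is handled by the outer induction on [sn M]; a descent into [u] is handled by the inner
    structural induction. *)
Lemma sn_Acc_smaller M : sn M -> Acc smaller M.
Proof.
  intros HM. cut (forall u, subterm u M -> Acc smaller u).
  { intros H. apply H. constructor. }
  induction HM as [M _ IH]. intros u.
  induction u; intros Hu; constructor; intros v Hv; inversion Hv; subst;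
    try (match goal with H : red _ _ |- _ =>
           destruct (subterm_red _ _ _ Hu H) as (t' & Ht & Hs); now apply (IH t') end).
  - apply IHu. eapply subterm_trans; [|exact Hu]. repeat constructor.
  - apply IHu1. eapply subterm_trans; [|exact Hu]. repeat constructor.
  - apply IHu2. eapply subterm_trans; [|exact Hu]. apply subterm_App_r. constructor.
  - apply IHu. eapply subterm_trans; [|exact Hu]. repeat constructor.
  - apply IHu. eapply subterm_trans; [|exact Hu]. repeat constructor.
Qed.

(** Guarding the transitive closure by accessibility makes the relation well founded on all terms,
    so [Fix] applies to arbitrary terms. *)
Definition below (N' N : term) : Prop :=
  Acc smaller N /\ clos_trans term smaller N' N.

Lemma below_smaller N' N : Acc smaller N -> smaller N' N -> below N' N.
Proof. split; trivial. now constructor. Qed.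

Lemma below_Acc N' N : below N' N -> Acc smaller N'.
Proof.
  intros [H1 H2]. apply Acc_clos_trans in H1.
  eapply Acc_incl with (R2 := clos_trans term smaller); [intros ? ? ?; now constructor|].
  eapply Acc_inv; eauto.
Qed.

Lemma below_trans N1 N2 N3 : below N1 N2 -> below N2 N3 -> below N1 N3.
Proof. intros [_ H1] [H2 H3]. split; trivial. eapply t_trans; eauto. Qed.

Lemma below_wf : well_founded below.
Proof.
  intros N. constructor. intros N' H. apply below_Acc in H.
  apply Acc_clos_trans in H. induction H as [N' _ IH].
  constructor. intros N'' H'. apply IH, H'.
Qed.

Lemma below_reds N' N P : Acc smaller N -> reds N P -> smaller N' P -> below N' N.
Proof.
  intros HN H. induction H as [|N P Q Hr H IH]; intros HP.
  - now apply below_smaller.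
  - apply below_trans with P.
    + apply IH; trivial. apply HN. now constructor.
    + apply below_smaller; trivial. now constructor.
Qed.

(** * Heads of instances *)

(** Lambda-variables are only renamed, so instantiation never puts an abstraction or a [Mu] in place
    of a variable. *)
Definition inst (f g : nat -> nat) (K : nat -> frame) (t : term) : term :=
  sub (fun x => Var (f x)) g K t.

(* [k] sits outside the [Mu] whose index 0 is substituted, hence the [wkm]. *)
Definition msub (k : frame) (t : term) : term :=
  fold_left
    (fun A p => sub Var id_nat (single 0 (fst p) (wkm (snd p))) A) k t.

(** Describes the frames under a [Mu] whose bound index has absorbed the surroundings [k]; with [k]
    empty it is [upf K]. *)
Definition consf (k : frame) (K : nat -> frame) (a : nat) : frame :=
  match a with 0 => mapf wkm k | S b => mapf wkm (K b) end.

Lemma inst_Lam f g K t :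
  inst f g K (Lam t) = Lam (inst (upren f) g (fun a => mapf wkl (K a)) t).
Proof. unfold inst. simpl. now rewrite upl_Var. Qed.

Lemma inst_Mu f g K t : inst f g K (Mu t) = Mu (inst f (upren g) (upf K) t).
Proof. reflexivity. Qed.

Lemma inst_subst0 f g K N M :
  inst f g K (subst0 N M) =
  subst0 (inst f g K N) (inst (upren f) g (fun a => mapf wkl (K a)) M).
Proof. unfold inst. now rewrite sub_subst0, upl_Var. Qed.

Lemma inst_rsub f g K N M :
  inst f (upren g) (upf K) (rsub 0 (wkm N) M) =
  rsub 0 (wkm (inst f g K N)) (inst f (upren g) (upf K) M).
Proof. rewrite !rsub_sub. apply (sub_single (fun x => Var (f x))). Qed.

Lemma inst_lsub f g K N M :
  inst f (upren g) (upf K) (lsub 0 (wkm N) M) =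
  lsub 0 (wkm (inst f g K N)) (inst f (upren g) (upf K) M).
Proof. rewrite !lsub_sub. apply (sub_single (fun x => Var (f x))). Qed.

Lemma ren_inst f' g' f g K t :
  ren f' g' (inst f g K t) =
  inst (fun x => f' (f x)) (fun a => g' (g a)) (fun a => mapf (ren f' g') (K a)) t.
Proof. apply ren_sub. Qed.

Lemma inst_id t : inst id_nat id_nat no_frame t = t.
Proof. apply sub_Var. Qed.

(** Absorbing arguments one after another amounts to one longer frame on index 0, since by
    [single_wkm] each new substitution leaves the arguments already in the frames alone. The result
    is still an instance of the same [t]. *)
Lemma msub_inst k k0 f g K t :
  msub k (inst f (upren g) (consf k0 K) t) =
  inst f (upren g) (consf (k0 ++ k) K) t.
Proof.
  revert k0. induction k as [|[b N] k IH]; intros k0; simpl.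
  - now rewrite app_nil_r.
  - change ((b, N) :: k) with ([(b, N)] ++ k). rewrite app_assoc, <- IH. f_equal.
    unfold inst. rewrite sub_sub. simpl. f_equal. extensionality a.
    destruct a; simpl; rewrite mapf_mapf; unfold single; simpl.
    + rewrite mapf_app. f_equal. apply mapf_ext. intros u. apply single_wkm.
    + rewrite app_nil_r. apply mapf_ext. intros u. apply single_wkm.
Qed.

Lemma upf_consf K : upf K = consf [] K.
Proof. extensionality a. now destruct a. Qed.

Lemma red_msub k M N : red M N -> red (msub k M) (msub k N).
Proof.
  revert M N. induction k as [|p k IH]; intros M N H; simpl; auto using red_sub.
Qed.

(** Induction along [below]. In an application the function part is lifted first, to [Lam Q']; the
    beta step is then performed in [N] itself, and the induction applies to its contractum. *)
Lemma inst_reds_Lam f g K N P :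
  Acc smaller N -> reds (inst f g K N) (Lam P) ->
  exists P', reds N (Lam P') /\
    reds (inst (upren f) g (fun a => mapf wkl (K a)) P') P.
Proof.
  intros HN. revert P. induction (below_wf N) as [N _ IH]. intros P H.
  destruct N as [x|A|A B|A|a A].
  - apply reds_Var_inv in H. discriminate.
  - rewrite inst_Lam in H. apply reds_Lam_inv in H.
    destruct H as (P' & [= <-] & H). eauto using reds_refl.
  - apply reds_App_Lam in H. destruct H as (Q & H1 & H2).
    assert (HA : below A (App A B)) by auto using below_smaller, smaller.
    apply (IH A HA (below_Acc _ _ HA)) in H1. destruct H1 as (Q' & H1 & H3).
    assert (Hr : reds (App A B) (App (Lam Q') B)) by auto using reds_App, reds_refl.
    assert (HQ : below (subst0 B Q') (App A B)).
    { apply (below_reds _ _ _ HN Hr). constructor. apply red_beta. }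
    destruct (IH _ HQ (below_Acc _ _ HQ) P) as (P' & H4 & H5).
    { rewrite inst_subst0. eapply reds_trans; [|apply H2].
      apply reds_subst0; trivial. apply reds_refl. }
    exists P'. split; trivial. eapply reds_trans; [apply Hr|].
    eapply reds_step; [apply red_beta|apply H4].
  - apply reds_Mu_inv in H. now destruct H as (P' & [=] & _).
  - apply reds_Nam_inv in H. now destruct H as (P' & [=]).
Qed.

(** The beta case goes as for abstractions. In the other two cases of an application, the side that
    becomes a [Mu] is lifted and contracted in [N]; the contractum is already a [Mu], which closes
    the case. *)
Lemma inst_reds_Mu f g K N P :
  Acc smaller N -> reds (inst f g K N) (Mu P) ->
  exists P', reds N (Mu P') /\ reds (inst f (upren g) (upf K) P') P.
Proof.
  intros HN. revert P. induction (below_wf N) as [N _ IH]. intros P H.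
  destruct N as [x|A|A B|A|a A].
  - apply reds_Var_inv in H. discriminate.
  - rewrite inst_Lam in H. apply reds_Lam_inv in H.
    now destruct H as (P' & [=] & _).
  - assert (HA : below A (App A B)) by auto using below_smaller, smaller.
    assert (HB : below B (App A B)) by auto using below_smaller, smaller.
    apply reds_App_Mu in H.
    destruct H as [(Q & H1 & H2)|[(Q & H1 & H2)|(Q & H1 & H2)]].
    + apply inst_reds_Lam in H1; [|exact (below_Acc _ _ HA)].
      destruct H1 as (Q' & H1 & H3).
      assert (Hr : reds (App A B) (App (Lam Q') B))
        by auto using reds_App, reds_refl.
      assert (HQ : below (subst0 B Q') (App A B)).
      { apply (below_reds _ _ _ HN Hr). constructor. apply red_beta. }
      destruct (IH _ HQ (below_Acc _ _ HQ) P) as (P' & H4 & H5).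
      { rewrite inst_subst0. eapply reds_trans; [|apply H2].
        apply reds_subst0; trivial. apply reds_refl. }
      exists P'. split; trivial. eapply reds_trans; [apply Hr|].
      eapply reds_step; [apply red_beta|apply H4].
    + apply (IH A HA (below_Acc _ _ HA)) in H1. destruct H1 as (Q' & H1 & H3).
      exists (rsub 0 (wkm B) Q'). split.
      * apply reds_trans with (App (Mu Q') B).
        -- auto using reds_App, reds_refl.
        -- apply red_reds, red_mu.
      * rewrite inst_rsub. eapply reds_trans; [|apply H2].
        apply reds_rsub; trivial. apply reds_refl.
    + apply (IH B HB (below_Acc _ _ HB)) in H1. destruct H1 as (Q' & H1 & H3).
      exists (lsub 0 (wkm A) Q'). split.
      * apply reds_trans with (App A (Mu Q')).
        -- auto using reds_App, reds_refl.
        -- apply red_reds, red_mu'.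
      * rewrite inst_lsub. eapply reds_trans; [|apply H2].
        apply reds_lsub; trivial. apply reds_refl.
  - rewrite inst_Mu in H. apply reds_Mu_inv in H.
    destruct H as (P' & [= <-] & H). eauto using reds_refl.
  - apply reds_Nam_inv in H. now destruct H as (P' & [=]).
Qed.

(** * Good instances *)

(* The quantification over renamings makes the condition on frames stable under
   the weakenings performed below binders. *)
Definition good : term -> term -> Prop :=
  Fix below_wf (fun _ => term -> Prop) (fun N rec T =>
    Acc smaller N /\ exists f g K, T = inst f g K N /\
      forall a, K a = [] \/
        forall f' g' N' U (H : below N' N), rec N' H U ->
          sn (plug (mapf (ren f' g') (K a)) U)).

(** The clause on frames in [good], with the recursive call replaced by [good] itself. The empty
    frame is a separate case: filling it gives back [U], whose normalization is the later
    [sn_good]. *)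
Definition good_frame (N : term) (k : frame) : Prop :=
  k = [] \/
  forall f g N' U, below N' N -> good N' U -> sn (plug (mapf (ren f g) k) U).

Lemma good_unfold N T :
  good N T <->
  Acc smaller N /\
  exists f g K, T = inst f g K N /\ forall a, good_frame N (K a).
Proof.
  unfold good at 1. rewrite Fix_eq; [reflexivity|].
  (* The unfolding equation of [Fix] requires the body to depend only on the values of the recursive
     call; extensionality makes the two calls equal. *)
  intros M r1 r2 H. replace r2 with r1; trivial.
  extensionality M'. extensionality HM. apply H.
Qed.

Lemma good_frame_below N' N k :
  below N' N -> good_frame N k -> good_frame N' k.
Proof. intros H [|Hk]; [now left|right]. eauto using below_trans. Qed.

Lemma good_frame_ren f g N k :
  good_frame N k -> good_frame N (mapf (ren f g) k).
Proof.
  intros [->|Hk]; [now left|right]. intros f' g' N' U HN HU.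
  rewrite mapf_mapf, (mapf_ext _ _ _ (ren_ren f' g' f g)). eauto.
Qed.

Lemma good_frame_upf N K a :
  (forall b, good_frame N (K b)) -> good_frame N (upf K a).
Proof. intros H. destruct a; [now left|]. now apply good_frame_ren. Qed.

Lemma good_ren f g N T : good N T -> good N (ren f g T).
Proof.
  rewrite !good_unfold. intros (HN & f' & g' & K & -> & HK).
  split; trivial. rewrite ren_inst. do 3 eexists. split; [reflexivity|].
  intros a. now apply good_frame_ren.
Qed.

Lemma good_refl N : Acc smaller N -> good N N.
Proof.
  intros HN. apply good_unfold. split; trivial.
  exists id_nat, id_nat, no_frame. rewrite inst_id. split; trivial. now left.
Qed.

(** Good frames for [N] stay good for terms below [N]. Each root contraction of the instance is
    lifted to [N], where its result is covered by the induction; strong normalization of filled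
    frames is called upon at [Nam]. *)
Lemma sn_good N T : good N T -> sn T.
Proof.
  revert T. induction (below_wf N) as [N _ IH]. intros T HT.
  apply good_unfold in HT. destruct HT as (HN & f & g & K & -> & HK).
  assert (IH' : forall N' f' g' K', below N' N ->
    (forall a, good_frame N (K' a)) -> sn (inst f' g' K' N')).
  { intros N' f' g' K' HN' HK'. apply (IH N' HN'). apply good_unfold.
    split; [apply (below_Acc _ _ HN')|]. exists f', g', K'. split; trivial.
    intros a. now apply good_frame_below with N. }
  destruct N as [x|A|A B|A|a A].
  - apply sn_Var.
  - rewrite inst_Lam. apply sn_Lam, IH'; [auto using below_smaller, smaller|].
    intros a. now apply good_frame_ren.
  - assert (HA : below A (App A B)) by auto using below_smaller, smaller.
    assert (HB : below B (App A B)) by auto using below_smaller, smaller.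
    change (sn (App (inst f g K A) (inst f g K B))). apply sn_App; auto; intros P HP.
    + apply inst_reds_Lam in HP; [|exact (below_Acc _ _ HA)].
      destruct HP as (P' & H1 & H2).
      apply sn_reds with (inst f g K (subst0 B P')).
      * apply IH'; trivial. apply below_reds with (App (Lam P') B); trivial.
        -- auto using reds_App, reds_refl.
        -- constructor. apply red_beta.
      * rewrite inst_subst0. apply reds_subst0; trivial. apply reds_refl.
    + apply inst_reds_Mu in HP; [|exact (below_Acc _ _ HA)].
      destruct HP as (P' & H1 & H2).
      apply sn_reds with (inst f g K (Mu (rsub 0 (wkm B) P'))).
      * apply IH'; trivial. apply below_reds with (App (Mu P') B); trivial.
        -- auto using reds_App, reds_refl.
        -- constructor. apply red_mu.
      * rewrite inst_Mu, inst_rsub. apply reds_map; [apply red_Mu|].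
        apply reds_rsub; trivial. apply reds_refl.
    + apply inst_reds_Mu in HP; [|exact (below_Acc _ _ HB)].
      destruct HP as (P' & H1 & H2).
      apply sn_reds with (inst f g K (Mu (lsub 0 (wkm A) P'))).
      * apply IH'; trivial. apply below_reds with (App A (Mu P')); trivial.
        -- auto using reds_App, reds_refl.
        -- constructor. apply red_mu'.
      * rewrite inst_Mu, inst_lsub. apply reds_map; [apply red_Mu|].
        apply reds_lsub; trivial. apply reds_refl.
  - rewrite inst_Mu. apply sn_Mu, IH'; [auto using below_smaller, smaller|].
    intros a. now apply good_frame_upf.
  - assert (HA : below A (Nam a A)) by auto using below_smaller, smaller.
    change (sn (Nam (g a) (plug (K a) (inst f g K A)))). apply sn_Nam.
    destruct (HK a) as [->|Ha]; [now apply IH'|].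
    (* The identity renaming is inserted to match the form of [good_frame]; the frame is filled with
       the instance of [A], which is good because [A] is below [Nam a A]. *)
    rewrite <- (mapf_id _ (K a) ren_id). apply (Ha _ _ A); trivial.
    apply good_unfold. split; [exact (below_Acc _ _ HA)|].
    exists f, g, K. split; trivial.
    intros b. now apply good_frame_below with (Nam a A).
Qed.

(** * Applications of a variable *)

(** The surroundings of one argument in an iterated application: [h] is everything to its left, [r]
    the arguments to its right. *)
Definition hole (h : term) (r : list term) : frame :=
  (false, h) :: map (pair true) r.

Lemma apps_snoc M Ps P : apps M (Ps ++ [P]) = App (apps M Ps) P.
Proof. unfold apps. now rewrite fold_left_app. Qed.

Lemma plug_hole M l U r : plug (hole (apps M l) r) U = apps M (l ++ U :: r).
Proof.
  unfold apps. rewrite fold_left_app. simpl.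
  generalize (App (fold_left App l M) U). induction r; simpl; auto.
Qed.

Lemma ren_apps f g M l : ren f g (apps M l) = apps (ren f g M) (map (ren f g) l).
Proof. revert M. induction l; intros M; simpl; trivial. Qed.

Lemma mapf_hole h M r : mapf h (hole M r) = hole (h M) (map h r).
Proof. unfold mapf, hole. simpl. now rewrite !map_map. Qed.

Lemma msub_hole_snoc h r P t :
  msub (hole h (r ++ [P])) t = rsub 0 (wkm P) (msub (hole h r) t).
Proof.
  rewrite rsub_sub. unfold msub, hole. simpl.
  now rewrite map_app, fold_left_app.
Qed.

Lemma apps_Var_not_Lam x Ps P : ~ reds (apps (Var x) Ps) (Lam P).
Proof.
  revert P. induction Ps as [|T Ps IH] using rev_ind; intros P H.
  - apply reds_Var_inv in H. discriminate.
  - rewrite apps_snoc in H. apply reds_App_Lam in H.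
    destruct H as (Q & H & _). apply (IH _ H).
Qed.

(** Induction from the last argument: either it becomes the [Mu] and absorbs the whole prefix, with
    [r] empty, or the prefix becomes one and the last argument is appended to [r]. *)
Lemma apps_Var_reds_Mu x Ps P :
  reds (apps (Var x) Ps) (Mu P) ->
  exists l T r Q, Ps = l ++ T :: r /\ reds T (Mu Q) /\
    reds (msub (hole (apps (Var x) l) r) Q) P.
Proof.
  revert P. induction Ps as [|T Ps IH] using rev_ind; intros P H.
  - apply reds_Var_inv in H. discriminate.
  - rewrite apps_snoc in H. apply reds_App_Mu in H.
    destruct H as [(Q & H1 & _)|[(Q & H1 & H2)|(Q & H1 & H2)]].
    + destruct (apps_Var_not_Lam _ _ _ H1).
    + apply IH in H1. destruct H1 as (l & U & r & Q' & -> & H3 & H4).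
      exists l, U, (r ++ [T]), Q'. rewrite <- app_assoc. repeat split; trivial.
      rewrite msub_hole_snoc. eapply reds_trans; [|apply H2].
      apply reds_rsub; trivial. apply reds_refl.
    + exists Ps, T, [], Q. rewrite lsub_sub in H2. auto.
Qed.

Lemma sn_apps_Var x Ps :
  Forall sn Ps ->
  (forall l T r Q, Ps = l ++ T :: r -> reds T (Mu Q) ->
     sn (msub (hole (apps (Var x) l) r) Q)) ->
  sn (apps (Var x) Ps).
Proof.
  induction Ps as [|T Ps IH] using rev_ind; intros Hsn H; [apply sn_Var|].
  apply Forall_app in Hsn. destruct Hsn as [HPs HT]. inversion_clear HT.
  rewrite apps_snoc. apply sn_App; trivial.
  - apply IH; trivial. intros l U r Q -> HQ.
    (* Each reduction step survives [rsub], so normalization after absorbing the last argument [T]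
       implies normalization before. *)
    apply (sn_map_inv (rsub 0 (wkm T))).
    + intros M N. rewrite !rsub_sub. apply red_sub.
    + rewrite <- msub_hole_snoc. apply H with U; trivial. now rewrite <- app_assoc.
  - intros P HP. destruct (apps_Var_not_Lam _ _ _ HP).
  - intros P HP. apply apps_Var_reds_Mu in HP.
    destruct HP as (l & U & r & Q & -> & HQ & HP). apply sn_Mu.
    apply sn_reds with (msub (hole (apps (Var x) l) (r ++ [T])) Q).
    + apply H with U; trivial. now rewrite <- app_assoc.
    + rewrite msub_hole_snoc. apply reds_rsub; trivial. apply reds_refl.
  - intros P HP. apply sn_Mu. rewrite lsub_sub.
    apply (H Ps T [] P); trivial.
Qed.

(** * Induction on lists of terms *)

Definition list_below (Ns' Ns : list term) : Prop :=
  exists l N N' r, Ns = l ++ N :: r /\ Ns' = l ++ N' :: r /\ below N' N.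

(** Nested induction, on the head along [below] and on the tail along its accessibility; a decrease
    in one leaves the other unchanged. *)
Lemma list_below_wf : well_founded list_below.
Proof.
  intros Ns. induction Ns as [|N Ns IH].
  - constructor. intros Ns' (l & N & N' & r & H & _). now destruct l.
  - revert Ns IH. induction (below_wf N) as [N _ IHN]. intros Ns HNs.
    induction HNs as [Ns HNs IHNs]. constructor.
    intros Ns' (l & M & M' & r & H1 & -> & HM).
    destruct l as [|M0 l]; injection H1 as -> ->.
    + apply IHN; trivial. now constructor.
    + apply IHNs. now exists l, M, M', r.
Qed.

Lemma sn_apps_good x Ns Ts : Forall2 good Ns Ts -> sn (apps (Var x) Ts).
Proof.
  (* [x] is generalized because renaming a frame also renames its head variable. *)
  revert x Ts. induction (list_below_wf Ns) as [Ns _ IH]. intros x Ts HT.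
  apply sn_apps_Var.
  { clear IH. induction HT; constructor; eauto using sn_good. }
  intros l T r Q -> HQ. apply Forall2_app_inv_r in HT.
  destruct HT as (Ns1 & Ns2 & H1 & H2 & ->).
  inversion H2 as [|N T' Ns3 r' HN H3]; subst.
  apply good_unfold in HN. destruct HN as (HN & f & g & K & -> & HK).
  apply inst_reds_Mu in HQ; trivial. destruct HQ as (Q' & HQ' & HQ).
  assert (Hb : below Q' N) by (apply below_reds with (Mu Q'); trivial; constructor).
  eapply sn_reds; [|apply (reds_map (msub _)); [apply red_msub|apply HQ]].
  (* The absorbed body is an instance of [Q'] whose one new frame, on index 0, is the hole that the
     absorbing argument left. *)
  rewrite upf_consf, msub_inst. apply (sn_good Q'). apply good_unfold.
  split; [apply (below_Acc _ _ Hb)|].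
  do 3 eexists. split; [reflexivity|]. intros [|a]; simpl.
  - apply (good_frame_ren _ _ _ (hole (apps (Var x) l) r)).
    (* Filling the new frame with [U] gives an application of a variable again, with [N] replaced by
       [N'], which is below [Q'] and so below [N]; the other arguments are only renamed. *)
    right. intros f' g' N' U HN' HU. rewrite mapf_hole, ren_apps, plug_hole. simpl.
    apply (IH (Ns1 ++ N' :: Ns3)).
    + exists Ns1, N, N', Ns3. eauto using below_trans.
    + clear - H1 H3 HU. apply Forall2_app.
      * induction H1; constructor; auto using good_ren.
      * constructor; trivial. induction H3; constructor; auto using good_ren.
  - apply good_frame_ren. now apply good_frame_below with N.
Qed.

Theorem theorem27 (x : nat) (Ms : list term)
  (hMs : forall M : term, In M Ms -> SN M) : SN (apps (Var x) Ms).
Proof.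
  (* Each term of [Ms] is taken as a good instance of itself, without frames. *)
  apply sn_SN, (sn_apps_good x Ms). revert hMs.
  induction Ms as [|M Ms IH]; intros hMs; constructor.
  - apply good_refl, sn_Acc_smaller, SN_sn, hMs. now left.
  - apply IH. intros N HN. apply hMs. now right.
Qed.
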